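(* Let $\mathcal{M}$ be a smooth manifold, and for each $i\in\{1,\dots,N\}$ let $\{f_{i,j}\}_{j=1}^{d_i}$ be smooth vector fields on $\mathcal{M}$ and $J_i:\mathcal{M}\to\mathbb{R}$ a smooth function. Let $\mathcal{U}\subset\mathcal{M}$ be an open submanifold such that, with $\mathcal{E}_i(x):=\mathrm{span}_{\mathbb{R}}\{f_{i,j}(x)\}_{j=1}^{d_i}$, each $\mathcal{E}_i$ is a regular distribution on $\mathcal{U}$ and $T_x\mathcal{U}=\mathcal{E}_1(x)\oplus\cdots\oplus\mathcal{E}_N(x)$ for all $x\in\mathcal{U}$, and such that, for each $i$, the family $\{f_{i,j}\}_{j=1}^{d_i}$ is linearly independent at every $x\in\mathcal{U}$. Let $x^\star\in\mathcal{U}$ satisfy $\mathrm{grad}_{\mathcal{E}_i}(J_i)|_{x^\star}=0$ for all $i\in\{1,\dots,N\}$. Then, with respect to the frame $\{f_{i,j}\}$, the linear map $A|_{x^\star}:T_{x^\star}\mathcal{U}\to T_{x^\star}\mathcal{U}$ admits the block matrix representation $A|_{x^\star}=[A_{ij}|_{x^\star}]_{i,j=1}^N$, $A_{ij}|_{x^\star}\in\mathbb{R}^{d_i\times d_j}$, with entries $$(A_{ij}|_{x^\star})_{p,q}=d\big(dJ_i[f_{i,p}]\big)[f_{j,q}]\Big|_{x^\star}=\mathrm{Hess}(J_i)[f_{i,p},f_{j,q}]\Big|_{x^\star}+dJ_i\big[\nabla_{f_{j,q}}f_{i,p}\big]\Big|_{x^\star}$$ for $p\in\{1,\dots,d_i\}$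 and $q\in\{1,\dots,d_j\}$, where $\mathrm{Hess}(J_i)$ is the Hessian of $J_i$ with respect to $g$.
   Context: A regular distribution is a smooth distribution of constant rank. $g$ denotes the Riemannian metric on $\mathcal{U}$ for which $\{f_{i,j}:1\le i\le N,\ 1\le j\le d_i\}$ is an orthonormal frame, and $\nabla$ its Levi-Civita connection. $\mathrm{grad}(J)$ is the $g$-gradient, $P_{\mathcal{E}_i}:T\mathcal{U}\to\mathcal{E}_i$ the $g$-orthogonal projection, and $\mathrm{grad}_{\mathcal{E}_i}(J):=P_{\mathcal{E}_i}\mathrm{grad}(J)=\sum_{j}dJ[f_{i,j}]f_{i,j}$. The Hessian is $\mathrm{Hess}(J)[X,Y]:=g(\nabla_X\mathrm{grad}(J),Y)$. The intrinsic Jacobian is the $(1,1)$-tensor $$A[X]:=\nabla_X\Big(\sum_{i=1}^N\mathrm{grad}_{\mathcal{E}_i}(J_i)\Big),$$ and $A|_{x^\star}$ is its value at $x^\star$. The $(i,j)$ block of the matrix of $A|_{x^\star}$ in the frame has entries determined by $A|_{x^\star}[f_{j,q}(x^\star)]=\sum_{i,p}(A_{ij}|_{x^\star})_{p,q}f_{i,p}(x^\star)$. *)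

(* Defs.v *)
From HB Require Import structures.
From mathcomp Require Import all_boot all_order all_algebra.
From mathcomp Require Import all_classical all_reals all_analysis.
Import Order.TTheory GRing.Theory Num.Theory.
Import numFieldNormedType.Exports.

Set Implicit Arguments.
Unset Strict Implicit.
Unset Printing Implicit Defensive.

Local Open Scope classical_set_scope.
Local Open Scope ring_scope.

Section Euclidean.
Context {R : realType} {n : nat}.

(* Meaningful for [W] open: all iterated partial derivatives of order at most
   [k] exist and are continuous on [W]. *)
Fixpoint Ck (k : nat) (W : set 'rV[R]_n) (F : 'rV[R]_n -> R) : Prop :=
  (forall y, W y -> {for y, continuous F}) /\
  match k with
  | 0 => True
  | k'.+1 => forall j : 'I_n,
      (forall y, W y -> derivable F y (delta_mx 0 j)) /\
      Ck k' W ('D_(delta_mx 0 j) F)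
  end.

Definition Cinfty (W : set 'rV[R]_n) (F : 'rV[R]_n -> R) : Prop :=
  forall k, Ck k W F.

End Euclidean.

(* [chart_map] and [chart_inv] are total functions, meaningful only on
   [chart_dom] and on its image. *)
Record chart (R : realType) (n : nat) (M : topologicalType) := Chart {
  chart_dom : set M;
  chart_map : M -> 'rV[R]_n;
  chart_inv : 'rV[R]_n -> M;
  chart_dom_open : open chart_dom;
  chart_img_open : open (chart_map @` chart_dom);
  chart_mapK : forall x, chart_dom x -> chart_inv (chart_map x) = x;
  chart_map_cont : {within chart_dom, continuous chart_map};
  chart_inv_cont : {within chart_map @` chart_dom, continuous chart_inv}
}.

(* The second chart is smooth with respect to the first. *)
Definition chart_compat (R : realType) (n : nat) (M : topologicalType)
    (phi psi : chart R n M) : Prop :=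
  forall j : 'I_n,
    Cinfty (chart_map phi @` (chart_dom phi `&` chart_dom psi))
           (fun y => chart_map psi (chart_inv phi y) 0 j).

Record manifold (R : realType) (n : nat) := Manifold {
  carrier :> topologicalType;
  manifold_hausdorff : hausdorff_space carrier;
  manifold_second_countable : @second_countable carrier;
  atlas : set (chart R n carrier);
  atlas_cover : forall x, exists2 phi, atlas phi & chart_dom phi x;
  atlas_compat : forall phi psi, atlas phi -> atlas psi -> chart_compat phi psi
}.

Section Tangent.
Context {R : realType} {n : nat} {M : manifold R n}.

Definition smooth_on (V : set M) (h : M -> R) : Prop :=
  forall phi, @atlas R n M phi ->
    Cinfty (chart_map phi @` (chart_dom phi `&` V)) (h \o chart_inv phi).

Definition smooth_near (x : M) (h : M -> R) : Prop :=
  exists V : set M, [/\ open V, V x & smooth_on V h].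

(* Derivations at [x] of the algebra of germs at [x] of smooth functions.
   A germ is represented by any total function that is smooth near [x]; the last
   clause fixes the irrelevant values, so that equal derivations of germs
   are equal as functions. *)
Definition is_derivation (x : M) (v : (M -> R) -> R^o) : Prop :=
  [/\ forall (a : R) h k, smooth_near x h -> smooth_near x k ->
        v (fun y => a * h y + k y) = a * v h + v k,
      forall h k, smooth_near x h -> smooth_near x k ->
        v (fun y => h y * k y) = v h * k x + h x * v k,
      forall h k, smooth_near x h -> smooth_near x k ->
        (\forall y \near x, h y = k y) -> v h = v k &
      forall h, ~ smooth_near x h -> v h = 0].

Definition derivations (x : M) : {pred (M -> R) -> R^o} :=
  fun v => `[< is_derivation x v >].

Lemma derivations_submod (x : M) : submod_closed (derivations x).
Proof.
split=> [|a u v /asboolP[u1 u2 u3 u4] /asboolP[v1 v2 v3 v4]]; apply/asboolP.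
  by split=> [b h k _ _|h k _ _||] //=; rewrite ?mulr0 ?mul0r addr0.
split=> [b h k hh hk|h k hh hk|h k hh hk e|h hh]; rewrite !fctE /GRing.scale /=.
- rewrite u1 // v1 // !mulrDr !mulrA (mulrC b a) -!addrA.
  by congr (_ + _); rewrite addrCA.
- by rewrite u2 // v2 // !mulrDr !mulrDl !mulrA (mulrC (h x) a) addrACA.
- by rewrite (u3 h k) // (v3 h k).
- by rewrite u4 // v4 // mulr0 addr0.
Qed.

HB.instance Definition _ (x : M) :=
  GRing.isSubmodClosed.Build R ((M -> R) -> R^o) (derivations x)
    (derivations_submod x).

Record tangent (x : M) := Tangent {
  tangent_val :> (M -> R) -> R^o;
  _ : tangent_val \in derivations x
}.

HB.instance Definition _ (x : M) := [isSub for @tangent_val x].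
HB.instance Definition _ (x : M) := [Choice of tangent x by <:].
HB.instance Definition _ (x : M) :=
  [SubChoice_isSubLmodule of tangent x by <:].

End Tangent.
Arguments tangent {R n} M x.

Section LinearAlgebra.
Context {R : realType} {V : lmodType R}.

Definition lin_span (m : nat) (e : 'I_m -> V) : set V :=
  [set v | exists c : 'I_m -> R, v = \sum_j c j *: e j].

Definition lin_indep (m : nat) (e : 'I_m -> V) : Prop :=
  forall c : 'I_m -> R, \sum_j c j *: e j = 0 -> forall j, c j = 0.

Definition has_dim (E : set V) (r : nat) : Prop :=
  exists2 b : 'I_r -> V, lin_indep b & E = lin_span b.

Definition direct_sum (I : finType) (E : I -> set V) : Prop :=
  forall v, exists! w : I -> V, (forall i, E i (w i)) /\ v = \sum_i w i.

End LinearAlgebra.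

Section Geometry.
Context {R : realType} {n : nat} {M : manifold R n}.

(* Vector fields, distributions, metrics and connections over an open subset
   [U] of [M] are total objects, whose values outside [U] are irrelevant. *)
Definition vfield := forall x : M, tangent M x.
Definition tangent_distribution := forall x : M, set (tangent M x).
Definition metric_tensor := forall x : M, tangent M x -> tangent M x -> R.
Definition connection := vfield -> vfield -> vfield.

(* [ddir J X] is the function dJ[X], also written X(J). *)
Definition ddir (J : M -> R) (X : vfield) : M -> R := fun x => X x J.

Definition smooth_vfield (U : set M) (X : vfield) : Prop :=
  forall (V : set M) (h : M -> R),
    open V -> V `<=` U -> smooth_on V h -> smooth_on V (ddir h X).

Definition smooth_distribution (U : set M) (E : tangent_distribution) : Prop :=
  forall x, U x -> exists V : set M, [/\ open V, V x, V `<=` U &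
    exists m (X : 'I_m -> vfield), (forall j, smooth_vfield V (X j)) /\
      forall y, V y -> E y = lin_span (fun j => X j y)].

Definition regular_distribution (U : set M) (E : tangent_distribution) : Prop :=
  smooth_distribution U E /\
  exists r, forall x, U x -> has_dim (E x) r.

Record riemannian (U : set M) (g : metric_tensor) : Prop := Riemannian {
  riemannian_linear : forall x (a : R) u v w, U x ->
    g x (a *: u + v) w = a * g x u w + g x v w;
  riemannian_sym : forall x u v, U x -> g x u v = g x v u;
  riemannian_pos : forall x u, U x -> u != 0 -> 0 < g x u u;
  riemannian_smooth : forall X Y, smooth_vfield U X -> smooth_vfield U Y ->
    smooth_on U (fun x => g x (X x) (Y x))
}.

Definition orthonormal_frame (U : set M) (g : metric_tensor)
    (N : nat) (d : 'I_N -> nat) (f : forall i, 'I_(d i) -> vfield) : Prop :=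
  forall x, U x -> forall i p j q,
    g x (f i p x) (f j q x) = ((i == j) && (p == q :> nat))%:R.

Record affine_connection (U : set M) (D : connection) : Prop :=
  AffineConnection {
  connection_smooth : forall X Y, smooth_vfield U X -> smooth_vfield U Y ->
    smooth_vfield U (D X Y);
  connection_linear : forall (h : M -> R) X X' Y x, smooth_on U h ->
    smooth_vfield U X -> smooth_vfield U X' -> smooth_vfield U Y -> U x ->
    D (fun y => h y *: X y + X' y) Y x = h x *: D X Y x + D X' Y x;
  connection_additive : forall X Y Y' x,
    smooth_vfield U X -> smooth_vfield U Y -> smooth_vfield U Y' -> U x ->
    D X (fun y => Y y + Y' y) x = D X Y x + D X Y' x;
  connection_leibniz : forall (h : M -> R) X Y x, smooth_on U h ->
    smooth_vfield U X -> smooth_vfield U Y -> U x ->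
    D X (fun y => h y *: Y y) x = h x *: D X Y x + ddir h X x *: Y x
}.

(* The Lie bracket [X, Y] applied to a function. *)
Definition bracket (X Y : vfield) (h : M -> R) : M -> R :=
  fun x => ddir (ddir h Y) X x - ddir (ddir h X) Y x.

Record levi_civita (U : set M) (g : metric_tensor) (D : connection) : Prop :=
  LeviCivita {
  levi_civita_connection : affine_connection U D;
  levi_civita_torsion_free : forall X Y x h,
    smooth_vfield U X -> smooth_vfield U Y -> U x -> smooth_near x h ->
    ddir h (D X Y) x - ddir h (D Y X) x = bracket X Y h x;
  levi_civita_metric : forall X Y Z x,
    smooth_vfield U X -> smooth_vfield U Y -> smooth_vfield U Z -> U x ->
    ddir (fun y => g y (Y y) (Z y)) X x =
      g x (D X Y x) (Z x) + g x (Y x) (D X Z x)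
}.

(* The vector representing dJ with respect to [g]. *)
Definition grad (g : metric_tensor) (J : M -> R) : vfield :=
  fun x => xget 0 [set u | forall v, g x u v = v J].

Definition orth_proj (g : metric_tensor) (E : tangent_distribution) (x : M)
    (v : tangent M x) : tangent M x :=
  xget 0 [set w | E x w /\ forall u, E x u -> g x (v - w) u = 0].

Definition grad_in (g : metric_tensor) (E : tangent_distribution)
    (J : M -> R) : vfield :=
  fun x => orth_proj g E (grad g J x).

Definition hess (g : metric_tensor) (D : connection) (J : M -> R)
    (X Y : vfield) : M -> R :=
  fun x => g x (D X (grad g J) x) (Y x).

Definition span_distribution (m : nat) (X : 'I_m -> vfield) :
    tangent_distribution :=
  fun x => lin_span (fun p => X p x).

Definition intrinsic_jacobian (g : metric_tensor) (D : connection) (N : nat)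
    (E : 'I_N -> tangent_distribution) (J : 'I_N -> M -> R)
    (X : vfield) : vfield :=
  D X (fun x => \sum_i grad_in g (E i) (J i) x).

(* [L] is the value at [x] of the (1,1)-tensor on [U] given by the operator [A]
   on vector fields. *)
Definition tensor_value (U : set M) (A : vfield -> vfield) (x : M)
    (L : {linear tangent M x -> tangent M x}) : Prop :=
  forall X, smooth_vfield U X -> L (X x) = A X x.

(* The [B i j] are the blocks of the matrix of [L] in the frame [f]. *)
Definition block_matrix (N : nat) (d : 'I_N -> nat)
    (f : forall i, 'I_(d i) -> vfield) (x : M)
    (L : tangent M x -> tangent M x)
    (B : forall i j, 'M[R]_(d i, d j)) : Prop :=
  forall j q, L (f j q x) = \sum_i \sum_p B i j p q *: f i p x.

End Geometry.
Arguments vfield {R n} M.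
Arguments tangent_distribution {R n} M.
Arguments metric_tensor {R n} M.
Arguments connection {R n} M.
Arguments span_distribution {R n M m} X x.
Arguments grad {R n M} g J x.
Arguments orth_proj {R n M} g E {x} v.
Arguments grad_in {R n M} g E J x.
Arguments intrinsic_jacobian {R n M} g D {N} E J X x.

(* Main.v *)
From HB Require Import structures.
Require Import Defs.
From mathcomp Require Import all_boot all_order all_algebra.
From mathcomp Require Import all_classical all_reals all_analysis.
From mathcomp Require Import lra.
Import Order.TTheory GRing.Theory Num.Theory.
Import numFieldNormedType.Exports.

Set Implicit Arguments.
Unset Strict Implicit.
Unset Printing Implicit Defensive.

Local Open Scope classical_set_scope.
Local Open Scope ring_scope.

(** In the orthonormal frame the two operations that are defined by a choice
    become explicit: the gradient of [J] is [\sum_k dJ[e_k] e_k] ([frame_gradE]),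
    and its projection on the span of a part of the frame keeps the terms of
    that part ([grad_inE]).  So on [U] the field that is differentiated is
    [W = \sum_(i, p) dJ_i[f_{i,p}] f_{i,p}], whose coefficients are smooth.

    A connection is tensorial in its direction: expanding [X] in the frame gives
    [D X W = \sum_k g(X, e_k) D e_k W] ([connection_tensorial]), and the
    right-hand side at a point is linear in the value of [X] there.  This
    is the linear map [A].  By the Leibniz rule
    [A[f_{j,q}] = \sum_(i, p) (dJ_i[f_{i,p}] D f_{j,q} f_{i,p}
                              + d(dJ_i[f_{i,p}])[f_{j,q}] f_{i,p})].
    At the critical point all the coefficients [dJ_i[f_{i,p}]] vanish, by
    independence of each family, and the second terms are the claimed entries.

    For the formula with the Hessian, write [dJ_i[f_{i,p}]] as
    [g(grad J_i, f_{i,p})] and differentiate along [f_{j,q}] with the metric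
    compatibility of the connection ([ddir_ddir]); this gives the Hessian with
    its arguments exchanged, and the absence of torsion makes it symmetric
    ([hess_sym]).

    The rest checks that the fields involved are smooth, so that the axioms of
    the connection apply: [C^k] functions are stable under sums and
    products, and so are smooth functions on open sets of the manifold.  Since
    fields are total while the connection is constrained on [U] only,
    equality on [U] must also be shown to be enough
    ([connection_vec_local], [connection_dir_local]). *)

(** * Functions of class C^k on Euclidean space *)

Section CkAlgebra.
Context {R : realType} {n : nat}.
Implicit Types (F G : 'rV[R]_n -> R) (W : set 'rV[R]_n).

Lemma open_eq_near W F G y : open W -> {in W, F =1 G} -> W y ->
  \forall z \near y, F z = G z.
Proof.
move=> oW FG Wy; apply: filterS (open_nbhs_nbhs (conj oW Wy)) => z Wz.
by apply: FG; rewrite inE.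
Qed.

Lemma Ck_subset k W W' F : W' `<=` W -> Ck k W F -> Ck k W' F.
Proof.
move=> sW; elim: k F => [|k IH] F /= [cF dF]; split=> //.
  by move=> y /sW; exact: cF.
  by move=> y /sW; exact: cF.
move=> j; have [dFj CF] := dF j; split; last exact: IH.
by move=> y /sW; exact: dFj.
Qed.

(** [Ck] constrains a function at the points of [W], but its derivatives there
    see the values nearby: this is why [W] has to be open.  The stability
    results below need it because the rules of differentiation identify the
    partial derivatives of a sum or a product on [W] only. *)
Lemma Ck_ext k W F G : open W -> {in W, F =1 G} -> Ck k W F -> Ck k W G.
Proof.
move=> oW; elim: k F G => [|k IH] F G FG [cF dF].
  split=> // y Wy; have FGy := open_eq_near oW FG Wy.
  rewrite /prop_for /continuous_at -FG ?inE//.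
  exact: cvg_trans (near_eq_cvg FGy) (cF _ Wy).
split=> [y Wy|j].
  have FGy := open_eq_near oW FG Wy.
  rewrite /prop_for /continuous_at -FG ?inE//.
  exact: cvg_trans (near_eq_cvg FGy) (cF _ Wy).
have [dFj CF] := dF j; split=> [y Wy|].
  exact: near_eq_derivable (open_eq_near oW FG Wy) (dFj _ Wy).
apply: IH CF => y; rewrite inE => Wy.
exact: near_eq_derive (open_eq_near oW FG Wy).
Qed.

Lemma Ck_weaken k W F : Ck k.+1 W F -> Ck k W F.
Proof.
elim: k F => [|k IH] F [cF dF]; split=> // j.
by have [dFj /IH] := dF j.
Qed.

Lemma Ck_cst k W (c : R) : Ck k W (cst c).
Proof.
elim: k c => [|k IH] c; split=> [y _|]; try exact: cst_continuous; first by [].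
move=> j; split=> [y _|]; first exact: derivable_cst.
suff -> : 'D_(delta_mx 0 j) (cst c : 'rV[R]_n -> R) = cst 0 by exact: IH.
by apply/funext => y; rewrite derive_cst.
Qed.

Lemma CkD k W F G : open W -> Ck k W F -> Ck k W G -> Ck k W (F \+ G).
Proof.
move=> oW; elim: k F G => [|k IH] F G [cF dF] [cG dG];
  have cFG y (Wy : W y) : {for y, continuous (F \+ G)} :=
    continuousD (cF _ Wy) (cG _ Wy); split=> // j.
have [dFj CF] := dF j; have [dGj CG] := dG j; split=> [y Wy|].
  exact: derivableD (dFj _ Wy) (dGj _ Wy).
apply: Ck_ext (IH _ _ CF CG) => // y; rewrite inE => Wy.
by rewrite /= -deriveD//; [exact: dFj|exact: dGj].
Qed.

Lemma CkM k W F G : open W -> Ck k W F -> Ck k W G -> Ck k W (F \* G).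
Proof.
move=> oW; elim: k F G => [|k IH] F G CF0 CG0; case: (CF0) => cF dF;
  case: (CG0) => cG dG;
  have cFG y (Wy : W y) : {for y, continuous (F \* G)} :=
    continuousM (cF _ Wy) (cG _ Wy); split=> // j.
have [dFj CF] := dF j; have [dGj CG] := dG j; split=> [y Wy|].
  exact: derivableM (dFj _ Wy) (dGj _ Wy).
have CF' := Ck_weaken CF0; have CG' := Ck_weaken CG0.
apply: Ck_ext (CkD oW (IH _ _ CF' CG) (IH _ _ CG' CF)) => // y.
by rewrite inE => Wy; rewrite /= -deriveM//; [exact: dFj|exact: dGj].
Qed.

End CkAlgebra.

(** * Smooth functions on a manifold *)

Section SmoothFunctions.
Context {R : realType} {n : nat} {M : manifold R n}.
Implicit Types (V W : set M) (h k : M -> R).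

(** The image is the set of points of the open chart image that the continuous
    inverse sends into [V]; it is thus open where [Ck] is evaluated. *)
Lemma chart_image_open (phi : chart R n M) V : open V ->
  open (chart_map phi @` (chart_dom phi `&` V)).
Proof.
move=> oV; rewrite openE => _ [x [dx Vx] <-].
have oI : open (chart_map phi @` chart_dom phi) := @chart_img_open _ _ _ phi.
have Iy : (chart_map phi @` chart_dom phi) (chart_map phi x) by exists x.
have : {in chart_map phi @` chart_dom phi, continuous (chart_inv phi)}.
  by rewrite -continuous_open_subspace//; exact: (@chart_inv_cont _ _ _ phi).
move=> /(_ (chart_map phi x)); rewrite inE => /(_ Iy) cinv.
have Vn : nbhs (chart_inv phi (chart_map phi x)) V.
  by rewrite chart_mapK//; exact: open_nbhs_nbhs.
apply: filterS (filterI (open_nbhs_nbhs (conj oI Iy)) (cinv _ Vn)) => z [].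
by case=> x' dx' <-; rewrite /= chart_mapK// => Vx'; exists x'.
Qed.

Lemma smooth_on_subset V W h : W `<=` V -> smooth_on V h -> smooth_on W h.
Proof.
move=> WV sh phi aphi k; apply: Ck_subset (sh phi aphi k).
by apply: image_subset; exact: setIS.
Qed.

Lemma smooth_on_ext V h k : open V -> {in V, h =1 k} ->
  smooth_on V h -> smooth_on V k.
Proof.
move=> oV hk sh phi aphi m; apply: Ck_ext (sh phi aphi m).
  exact: chart_image_open.
move=> y; rewrite inE => -[x [dx Vx] <-] /=; rewrite chart_mapK//.
by apply: hk; rewrite inE.
Qed.

Lemma smooth_on_cst V (c : R) : smooth_on V (fun=> c).
Proof. by move=> phi _ m; exact: Ck_cst. Qed.

Lemma smooth_onD V h k : open V -> smooth_on V h -> smooth_on V k ->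
  smooth_on V (fun y => h y + k y).
Proof.
move=> oV sh sk phi aphi m.
by apply: CkD; [exact: chart_image_open|exact: sh|exact: sk].
Qed.

Lemma smooth_onM V h k : open V -> smooth_on V h -> smooth_on V k ->
  smooth_on V (fun y => h y * k y).
Proof.
move=> oV sh sk phi aphi m.
by apply: CkM; [exact: chart_image_open|exact: sh|exact: sk].
Qed.

Lemma smooth_on_near V h x : open V -> V x -> smooth_on V h -> smooth_near x h.
Proof. by move=> oV Vx sh; exists V. Qed.

End SmoothFunctions.

(** * Smooth vector fields *)

Section VectorFields.
Context {R : realType} {n : nat} {M : manifold R n}.
Implicit Types (U V : set M) (h k : M -> R) (X Y : vfield M) (x : M).

Lemma vfield_ext X Y : (forall x, X x = Y x) -> X = Y.
Proof. exact: functional_extensionality_dep. Qed.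

Lemma tangent_sumE x (I : Type) (r : seq I) (v : I -> tangent M x) h :
  (\sum_(i <- r) v i) h = \sum_(i <- r) v i h.
Proof. by elim/big_rec2: _ => // k a b _ <-. Qed.

Lemma tangent_near_eq x (v : tangent M x) h k :
  smooth_near x h -> smooth_near x k -> (\forall y \near x, h y = k y) ->
  v h = v k.
Proof. by case: v => v /= /asboolP[_ _ + _] => /[apply]/[apply]/[apply]. Qed.

Lemma smooth_vfield_subset U V X : V `<=` U ->
  smooth_vfield U X -> smooth_vfield V X.
Proof. by move=> VU sX W h oW WV; apply: sX => // y /WV /VU. Qed.

Lemma smooth_vfield_ext U X Y : (forall x, U x -> X x = Y x) ->
  smooth_vfield U X -> smooth_vfield U Y.
Proof.
move=> XY sX W h oW WU sh; apply: smooth_on_ext (sX W h oW WU sh) => // y.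
by rewrite inE => /WU Uy; rewrite /ddir XY.
Qed.

Lemma smooth_vfield0 U : smooth_vfield U (fun x => 0 : tangent M x).
Proof. by move=> W h oW WU sh; exact: smooth_on_cst. Qed.

Lemma smooth_vfieldD U X Y : smooth_vfield U X -> smooth_vfield U Y ->
  smooth_vfield U (fun x => X x + Y x).
Proof.
move=> sX sY W h oW WU sh.
exact: smooth_onD oW (sX W h oW WU sh) (sY W h oW WU sh).
Qed.

Lemma smooth_vfieldZ U a X : smooth_on U a -> smooth_vfield U X ->
  smooth_vfield U (fun x => a x *: X x).
Proof.
move=> sa sX W h oW WU sh.
exact: smooth_onM oW (smooth_on_subset WU sa) (sX W h oW WU sh).
Qed.

Lemma smooth_vfield_sum U (I : Type) (r : seq I) (a : I -> M -> R)
    (X : I -> vfield M) :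
  (forall i, smooth_on U (a i)) -> (forall i, smooth_vfield U (X i)) ->
  smooth_vfield U (fun x => \sum_(i <- r) a i x *: X i x).
Proof.
move=> sa sX; elim: r => [|i r IH].
  by apply: (smooth_vfield_ext _ (@smooth_vfield0 U)) => x _; rewrite big_nil.
apply: (smooth_vfield_ext _ (smooth_vfieldD (smooth_vfieldZ (sa i) (sX i)) IH)).
by move=> x _; rewrite big_cons.
Qed.

End VectorFields.

(** * Locality and finite sums for affine connections *)

Section Connections.
Context {R : realType} {n : nat} {M : manifold R n}.
Variables (U : set M) (U_open : open U) (D : connection M).
Hypothesis D_affine : affine_connection U D.
Implicit Types (X Y : vfield M) (h : M -> R) (x : M).

Lemma connection_vec0 X x : smooth_vfield U X -> U x -> D X (fun=> 0) x = 0.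
Proof.
move=> sX Ux; have s0 := @smooth_vfield0 R n M U.
have := connection_additive D_affine sX s0 s0 Ux.
rewrite (_ : (fun y => 0 + 0) = (fun=> 0)); last first.
  by apply: vfield_ext => y; rewrite addr0.
by move/eqP; rewrite eq_sym -subr_eq0 addrK => /eqP.
Qed.

Lemma connection_dir0 Y x : smooth_vfield U Y -> U x -> D (fun=> 0) Y x = 0.
Proof.
move=> sY Ux; have s0 := @smooth_vfield0 R n M U.
have := connection_linear D_affine (smooth_on_cst U (-1)) s0 s0 sY Ux.
rewrite (_ : (fun y => -1 *: 0 + 0) = (fun=> 0)); last first.
  by apply: vfield_ext => y; rewrite scaler0 addr0.
by rewrite scaleN1r addNr.
Qed.

(** The indicator of the complement of [U] vanishes on [U], hence is smooth there
    whatever [U] is; multiplying by it kills the values on [U] of a field and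
    keeps the others.  It lets the algebraic axioms of a connection, which
    speak of total fields, compare fields that agree on [U]. *)
Lemma smooth_indicC : smooth_on U (\1_(~` U) : M -> R).
Proof.
apply: smooth_on_ext (smooth_on_cst U 0) => // y; rewrite inE => Uy.
by rewrite indicE memNset.
Qed.

Lemma indicC_on x : U x -> \1_(~` U) x = 0 :> R.
Proof. by move=> Ux; rewrite indicE memNset. Qed.

Lemma indicC_glue X X' : (forall y, U y -> X y = X' y) ->
  X = fun y => \1_(~` U) y *: (X y - X' y) + X' y.
Proof.
move=> XX; apply: vfield_ext => y; rewrite indicE.
have [Uy|nUy] := pselect (U y); first by rewrite memNset// scale0r add0r XX.
by rewrite mem_set// scale1r subrK.
Qed.

Lemma smooth_vfieldB X X' : smooth_vfield U X -> smooth_vfield U X' ->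
  smooth_vfield U (fun y => X y - X' y).
Proof.
move=> sX sX'; apply: (smooth_vfield_ext _ (smooth_vfieldD sX
  (smooth_vfieldZ (smooth_on_cst U (-1)) sX'))) => y _ /=.
by rewrite scaleN1r.
Qed.

(** [Y] is [Y'] plus the indicator times [Y - Y'].  In the Leibniz rule for this
    product the indicator and the field [Y - Y'] both vanish on [U], so both
    terms do. *)
Lemma connection_vec_local X Y Y' x : smooth_vfield U X ->
  smooth_vfield U Y -> smooth_vfield U Y' -> (forall y, U y -> Y y = Y' y) ->
  U x -> D X Y x = D X Y' x.
Proof.
move=> sX sY sY' YY' Ux; rewrite (indicC_glue YY').
have sB := smooth_vfieldB sY sY'.
rewrite (connection_additive D_affine sX (smooth_vfieldZ smooth_indicC sB))//.
rewrite (connection_leibniz D_affine smooth_indicC sX sB Ux).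
by rewrite indicC_on// YY'// subrr scaler0 scale0r !add0r.
Qed.

Lemma connection_dir_local X X' Y x : smooth_vfield U Y ->
  smooth_vfield U X -> smooth_vfield U X' -> (forall y, U y -> X y = X' y) ->
  U x -> D X Y x = D X' Y x.
Proof.
move=> sY sX sX' XX' Ux; rewrite (indicC_glue XX').
have sB := smooth_vfieldB sX sX'.
rewrite (connection_linear D_affine smooth_indicC sB)//.
by rewrite indicC_on// scale0r add0r.
Qed.

Lemma connection_vec_sum (I : Type) (r : seq I) (a : I -> M -> R)
    (e : I -> vfield M) X x :
  (forall k, smooth_on U (a k)) -> (forall k, smooth_vfield U (e k)) ->
  smooth_vfield U X -> U x ->
  D X (fun y => \sum_(k <- r) a k y *: e k y) x =
  \sum_(k <- r) (a k x *: D X (e k) x + ddir (a k) X x *: e k x).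
Proof.
move=> sa se sX Ux; elim: r => [|k r IH].
  rewrite big_nil -[RHS](connection_vec0 sX Ux).
  have -> // : (fun y => \sum_(k <- [::]) a k y *: e k y) = (fun=> 0).
  by apply: vfield_ext => y; rewrite big_nil.
rewrite big_cons -IH -(connection_leibniz D_affine)//.
rewrite -(connection_additive D_affine) //.
- have -> // : (fun y => \sum_(j <- k :: r) a j y *: e j y) =
      (fun y => a k y *: e k y + \sum_(j <- r) a j y *: e j y).
    by apply: vfield_ext => y; rewrite big_cons.
- exact: smooth_vfieldZ.
- exact: smooth_vfield_sum.
Qed.

Lemma connection_dir_sum (I : Type) (r : seq I) (a : I -> M -> R)
    (e : I -> vfield M) Y x :
  (forall k, smooth_on U (a k)) -> (forall k, smooth_vfield U (e k)) ->
  smooth_vfield U Y -> U x ->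
  D (fun y => \sum_(k <- r) a k y *: e k y) Y x =
  \sum_(k <- r) a k x *: D (e k) Y x.
Proof.
move=> sa se sY Ux; elim: r => [|k r IH].
  rewrite big_nil -[RHS](connection_dir0 sY Ux).
  have -> // : (fun y => \sum_(k <- [::]) a k y *: e k y) = (fun=> 0).
  by apply: vfield_ext => y; rewrite big_nil.
rewrite big_cons -IH -(connection_linear D_affine)//.
- have -> // : (fun y => \sum_(j <- k :: r) a j y *: e j y) =
      (fun y => a k y *: e k y + \sum_(j <- r) a j y *: e j y).
    by apply: vfield_ext => y; rewrite big_cons.
- exact: smooth_vfield_sum.
Qed.

End Connections.

(** * Gradient and orthogonal projection in an orthonormal basis *)

Section MetricAlgebra.
Context {R : realType} {n : nat} {M : manifold R n}.
Variables (U : set M) (g : metric_tensor M).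
Arguments g : clear implicits.
Variables (g_riemannian : riemannian U g) (x : M) (Ux : U x).
Implicit Types u v w : tangent M x.

Lemma metric0l w : g x 0 w = 0.
Proof.
have := riemannian_linear g_riemannian (-1) 0 0 w Ux.
by rewrite scaler0 addr0 mulN1r addNr.
Qed.

Lemma metric_suml (I : Type) (r : seq I) (c : I -> R) (v : I -> tangent M x) w :
  g x (\sum_(k <- r) c k *: v k) w = \sum_(k <- r) c k * g x (v k) w.
Proof.
elim: r => [|k r IH]; first by rewrite !big_nil metric0l.
by rewrite !big_cons (riemannian_linear g_riemannian)// IH.
Qed.

Lemma metricBl u v w : g x (u - v) w = g x u w - g x v w.
Proof.
rewrite addrC -scaleN1r (riemannian_linear g_riemannian)//.
by rewrite mulN1r addrC.
Qed.

Lemma orthonormal_coord (I : finType) (b : I -> tangent M x) (c : I -> R) l :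
  (forall k l, g x (b k) (b l) = (k == l)%:R) ->
  g x (\sum_k c k *: b k) (b l) = c l.
Proof.
move=> b_on; rewrite metric_suml (bigD1 l)//= b_on eqxx mulr1.
by rewrite big1 ?addr0// => k /negPf kl; rewrite b_on kl mulr0.
Qed.

(** The vector on the right represents [dJ] because [v J] is linear in [v];
    it is the only one because its coordinates [g(u, b_k)] are prescribed. *)
Lemma gradE (I : finType) (b : I -> tangent M x) (J : M -> R) :
  (forall k l, g x (b k) (b l) = (k == l)%:R) ->
  (forall v, v = \sum_k g x v (b k) *: b k) ->
  grad g J x = \sum_k b k J *: b k.
Proof.
move=> b_on b_exp; apply: xget_unique => [v|u uP] /=.
  rewrite [in RHS](b_exp v) tangent_sumE metric_suml; apply: eq_bigr => k _.
  by rewrite mulrC (riemannian_sym g_riemannian).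
by rewrite [LHS]b_exp; apply: eq_bigr => k _; rewrite uP.
Qed.

(** A vector of the span with [v - w] orthogonal to it has the same inner products
    with the [b_p] as [v]; these are its coordinates. *)
Lemma orth_projE m (b : 'I_m -> vfield M) v :
  (forall p q, g x (b p x) (b q x) = (p == q)%:R) ->
  orth_proj g (span_distribution b) v = \sum_p g x v (b p x) *: b p x.
Proof.
move=> b_on.
have coord c q := orthonormal_coord c q b_on.
apply: xget_unique => [|w [[c ->] wP]].
  split=> [|u [c ->]]; first by exists (fun p => g x v (b p x)).
  rewrite (riemannian_sym g_riemannian)// metric_suml big1// => p _.
  by rewrite (riemannian_sym g_riemannian)// metricBl coord subrr mulr0.
apply: eq_bigr => p _; congr (_ *: _); apply/eqP; rewrite eq_sym -subr_eq0.
rewrite -[X in _ - X](coord c p) -metricBl; apply/eqP/wP.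
(* Orthogonality is tested against the vector [b p x] of the span. *)
exists (fun q => (q == p)%:R); rewrite (bigD1 p)//= eqxx scale1r.
by rewrite big1 ?addr0// => q /negPf ->; rewrite scale0r.
Qed.

End MetricAlgebra.

(** * Symmetry of the Hessian *)

Section Hessian.
Context {R : realType} {n : nat} {M : manifold R n}.
Variables (U : set M) (U_open : open U) (g : metric_tensor M).
Arguments g : clear implicits.
Variables (D : connection M) (D_lc : levi_civita U g D).
Variables (J : M -> R) (J_smooth : smooth_on U J).
Hypothesis grad_smooth : smooth_vfield U (grad g J).
Hypothesis gradP : forall x v, U x -> g x (grad g J x) v = v J.

(** Differentiating [dJ[Y] = g(grad J, Y)] along [X] with a metric connection
    produces one term for each factor. *)
Lemma ddir_ddir X Y x : smooth_vfield U X -> smooth_vfield U Y -> U x ->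
  ddir (ddir J Y) X x = hess g D J X Y x + ddir J (D X Y) x.
Proof.
move=> sX sY Ux; rewrite /ddir -[in RHS]gradP//.
rewrite -(levi_civita_metric D_lc sX grad_smooth sY Ux) /ddir.
have sYJ : smooth_on U (ddir J Y) by exact: sY.
have YJE : {in U, ddir J Y =1 fun y => g y (grad g J y) (Y y)}.
  by move=> y; rewrite inE => Uy; rewrite gradP.
apply: tangent_near_eq.
- exact: smooth_on_near sYJ.
- exact: smooth_on_near (smooth_on_ext U_open YJE sYJ).
- apply: filterS (open_nbhs_nbhs (conj U_open Ux)) => y Uy.
  by apply: YJE; rewrite inE.
Qed.

(** By [ddir_ddir], the difference of the two sides is [[X, Y] J] minus the
    derivative of [J] along [D X Y - D Y X], and the connection has no torsion. *)
Lemma hess_sym X Y x : smooth_vfield U X -> smooth_vfield U Y -> U x ->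
  hess g D J X Y x = hess g D J Y X x.
Proof.
move=> sX sY Ux.
have Jn := smooth_on_near U_open Ux J_smooth.
have := levi_civita_torsion_free D_lc sX sY Ux Jn.
by rewrite /bracket (ddir_ddir sX sY Ux) (ddir_ddir sY sX Ux); lra.
Qed.

End Hessian.

(** * Connections in an orthonormal frame *)

Section OrthonormalFrame.
Context {R : realType} {n : nat} {M : manifold R n}.
Variables (U : set M) (U_open : open U) (g : metric_tensor M).
Arguments g : clear implicits.
Hypothesis g_riemannian : riemannian U g.
Variables (I : finType) (e : I -> vfield M).
Hypothesis e_smooth : forall k, smooth_vfield U (e k).
Hypothesis e_orthonormal : forall x, U x -> forall k l,
  g x (e k x) (e l x) = (k == l)%:R.
Hypothesis e_span : forall x, U x -> forall v : tangent M x,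
  exists c : I -> R, v = \sum_k c k *: e k x.

Lemma frame_expansion x (v : tangent M x) : U x ->
  v = \sum_k g x v (e k x) *: e k x.
Proof.
move=> Ux; have [c ->] := e_span Ux v; apply: eq_bigr => k _.
by rewrite (orthonormal_coord g_riemannian Ux _ _ (e_orthonormal Ux)).
Qed.

Lemma frame_gradE J x : U x -> grad g J x = \sum_k ddir J (e k) x *: e k x.
Proof.
move=> Ux; apply: (gradE g_riemannian Ux _ (e_orthonormal Ux)) => v.
exact: frame_expansion.
Qed.

Lemma grad_metric J x v : U x -> g x (grad g J x) v = v J.
Proof.
move=> Ux; rewrite frame_gradE// (metric_suml g_riemannian Ux).
rewrite {2}(frame_expansion v Ux) tangent_sumE; apply: eq_bigr => k _.
by rewrite (riemannian_sym g_riemannian)// mulrC.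
Qed.

Lemma smooth_grad J : smooth_on U J -> smooth_vfield U (grad g J).
Proof.
move=> sJ; apply: (@smooth_vfield_ext _ _ _ U
  (fun x => \sum_k ddir J (e k) x *: e k x)).
  by move=> x Ux; rewrite frame_gradE.
by apply: smooth_vfield_sum => // k; exact: e_smooth.
Qed.

Lemma grad_inE m (b : 'I_m -> vfield M) J x : U x ->
  (forall p q, g x (b p x) (b q x) = (p == q)%:R) ->
  grad_in g (span_distribution b) J x = \sum_p ddir J (b p) x *: b p x.
Proof.
move=> Ux b_on; rewrite /grad_in (orth_projE g_riemannian)//.
by apply: eq_bigr => p _; rewrite grad_metric.
Qed.

Variables (D : connection M) (D_affine : affine_connection U D).

(** The coefficients [g(X, e_k)] of [X] are smooth functions on [U], so linearity
    over smooth functions applies to the expansion of [X] on the whole of [U]. *)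
Lemma connection_tensorial X Y x : smooth_vfield U X -> smooth_vfield U Y ->
  U x -> D X Y x = \sum_k g x (X x) (e k x) *: D (e k) Y x.
Proof.
move=> sX sY Ux; pose a k y := g y (X y) (e k y).
have sa k : smooth_on U (a k) by exact: (riemannian_smooth g_riemannian).
rewrite -(connection_dir_sum D_affine _ sa e_smooth sY Ux).
apply: (connection_dir_local U_open D_affine sY sX) => //.
  exact: smooth_vfield_sum.
by move=> y Uy; exact: frame_expansion.
Qed.

Lemma connection_endo_linear Y x : U x ->
  linear (fun v : tangent M x => \sum_k g x v (e k x) *: D (e k) Y x).
Proof.
move=> Ux a u v; rewrite scaler_sumr -big_split /=; apply: eq_bigr => k _.
by rewrite (riemannian_linear g_riemannian)// scalerDl scalerA.
Qed.

Lemma connection_tensor_value Y x : smooth_vfield U Y -> U x ->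
  exists A : {linear tangent M x -> tangent M x},
    tensor_value U (fun X => D X Y) A.
Proof.
move=> sY Ux; pose L v := \sum_k g x v (e k x) *: D (e k) Y x.
pose LM := GRing.isLinear.Build R _ _ _ L (connection_endo_linear Y Ux).
pose A : {linear tangent M x -> tangent M x} := HB.pack L LM.
by exists A => X sX; rewrite connection_tensorial.
Qed.

End OrthonormalFrame.

(** * The frame of a direct sum and the Jacobian *)

Section DirectSumFrame.
Context {R : realType} {V : lmodType R} {N : nat} {d : 'I_N -> nat}.

(** The dependent pairs [(i, p)] index the union of the families, so that the
    frame of the whole space is a family over one finite type. *)
Lemma direct_sum_span (b : forall i, 'I_(d i) -> V) :
  direct_sum (fun i => lin_span (b i)) ->
  forall v, exists c : {i : 'I_N & 'I_(d i)} -> R,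
    v = \sum_k c k *: b (tag k) (tagged k).
Proof.
move=> ds v; have [w [[wE ->] _]] := ds v.
pose c i := projT1 (cid (wE i)).
exists (fun k => c (tag k) (tagged k)).
rewrite -(sig_big_dep xpredT (fun=> xpredT) (fun i p => c i p *: b i p)) /=.
by apply: eq_bigr => i _; exact: projT2 (cid (wE i)).
Qed.

End DirectSumFrame.

Theorem theorem2 (R : realType) (n : nat) (M : manifold R n)
    (N : nat) (d : 'I_N -> nat)
    (f : forall i : 'I_N, 'I_(d i) -> vfield M) (J : 'I_N -> M -> R)
    (f_smooth : forall i p, smooth_vfield setT (f i p))
    (J_smooth : forall i, smooth_on setT (J i))
    (U : set M) (U_open : open U)
    (E_regular : forall i, regular_distribution U (span_distribution (f i)))
    (E_direct : forall x, U x ->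
      direct_sum (fun i => span_distribution (f i) x))
    (f_indep : forall i x, U x -> lin_indep (fun p => f i p x))
    (g : metric_tensor M) (g_riemannian : riemannian U g)
    (g_orthonormal : orthonormal_frame U g f)
    (nabla : connection M) (nabla_levi_civita : levi_civita U g nabla)
    (xstar : M) (xstar_U : U xstar)
    (xstar_crit : forall i,
      grad_in g (span_distribution (f i)) (J i) xstar = 0) :
  exists A : {linear tangent M xstar -> tangent M xstar},
    tensor_value U
      (intrinsic_jacobian g nabla (fun i => span_distribution (f i)) J) A /\
    exists Ab : forall i j : 'I_N, 'M[R]_(d i, d j),
      block_matrix f A Ab /\
      forall i j (p : 'I_(d i)) (q : 'I_(d j)),
        Ab i j p q = ddir (ddir (J i) (f i p)) (f j q) xstar /\
        ddir (ddir (J i) (f i p)) (f j q) xstar =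
          hess g nabla (J i) (f i p) (f j q) xstar
          + ddir (J i) (nabla (f j q) (f i p)) xstar.
Proof.
pose I := {i : 'I_N & 'I_(d i)}.
pose e (k : I) := f (tag k) (tagged k).
have f_smoothU i p : smooth_vfield U (f i p).
  exact: smooth_vfield_subset (f_smooth i p).
have e_smooth k : smooth_vfield U (e k) by exact: f_smoothU.
have J_smoothU i : smooth_on U (J i) by exact: smooth_on_subset (J_smooth i).
have f_on i x (Ux : U x) p q : g x (f i p x) (f i q x) = (p == q)%:R.
  by rewrite (g_orthonormal x Ux) eqxx.
(* The orthonormality hypothesis compares the values of [p] and [q], which may
   live in different ordinal types; once [i = j] this is equality of [k]
   and [l] as dependent pairs. *)
have e_on x (Ux : U x) k l : g x (e k x) (e l x) = (k == l)%:R.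
  rewrite (g_orthonormal x Ux) -tag_eqE /tag_eq.
  case: k l => [i p] [j q] /=; have [ij|//] := eqVneq i j.
  by move: q; rewrite -ij => q; rewrite tagged_asE.
have e_span x (Ux : U x) := direct_sum_span (E_direct x Ux).
pose W (x : M) := \sum_i grad_in g (span_distribution (f i)) (J i) x.
pose a (k : I) := ddir (J (tag k)) (e k).
have a_smooth k : smooth_on U (a k) by exact: e_smooth.
have WE x : U x -> W x = \sum_k a k x *: e k x.
  move=> Ux.
  rewrite -(sig_big_dep xpredT (fun=> xpredT)
    (fun i p => ddir (J i) (f i p) x *: f i p x)) /=.
  apply: eq_bigr => i _.
  by rewrite (grad_inE g_riemannian e_on e_span)//; exact: f_on.
(* The gradient of [J_i] in the distribution has the [a k] as coefficients in an
   independent family. *)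
have a_star k : a k xstar = 0.
  apply: (f_indep _ _ xstar_U (fun p => ddir (J (tag k)) (f (tag k) p) xstar)).
  rewrite -(grad_inE g_riemannian e_on e_span)//; exact: f_on.
have sum_smooth : smooth_vfield U (fun x => \sum_k a k x *: e k x).
  exact: smooth_vfield_sum.
have W_smooth : smooth_vfield U W.
  by apply: (smooth_vfield_ext _ sum_smooth) => x Ux; rewrite WE.
have [nabla_affine _ _] := nabla_levi_civita.
have [A AP] := connection_tensor_value U_open g_riemannian e_smooth e_on e_span
  nabla_affine W_smooth xstar_U.
exists A; split; first exact: AP.
exists (fun i j => \matrix_(p, q) ddir (ddir (J i) (f i p)) (f j q) xstar).
split=> [j q|i j p q].
  rewrite AP//.
  (* [W] is given by the frame formula on [U] only, so it is replaced by locality. *)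
  rewrite (connection_vec_local U_open nabla_affine _ W_smooth sum_smooth)//.
  rewrite (connection_vec_sum nabla_affine)//.
  rewrite [RHS](sig_big_dep xpredT (fun=> xpredT)) /=; apply: eq_bigr => k _.
  by rewrite a_star scale0r add0r mxE.
rewrite mxE; split=> //.
have gradP x v : U x -> g x (grad g (J i) x) v = v (J i).
  exact: (grad_metric g_riemannian e_on e_span).
have grad_sm := smooth_grad U_open g_riemannian e_smooth e_on e_span (J_smoothU i).
(* [ddir_ddir] yields the Hessian at [(f j q, f i p)]. *)
rewrite (hess_sym U_open nabla_levi_civita (J_smoothU i))//.
exact: (ddir_ddir U_open nabla_levi_civita (J_smoothU i) grad_sm gradP).
Qed.
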